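(* Let $\Gamma$ be an inverse semigroup and define $j:G_u(\Gamma)\to\{0,1\}^{\Gamma}$ by $j(X)(x)=1$ if $X\prec x$ and $j(X)(x)=0$ otherwise. The map $j$ is injective. If $\Gamma$ satisfies condition (L), then the topology induced on $G_u(\Gamma)$ via $j$ from $\{0,1\}^{\Gamma}$ (product topology, $\{0,1\}$ discrete) agrees with the topology $\mathcal{T}$ of $G_u(\Gamma)$.
   Context: In an inverse semigroup, $x\prec y$ means $xy^{-1}=xx^{-1}$ (natural partial order); then $x$ is called a precessor of $y$. The symbol $0$ denotes the (unique) element $z$ with $z\prec x$ for all $x$, if it exists; conditions of the form ''$\neq 0$'' are vacuous if there is no such element. Condition (L): any $x,y\in\Gamma$ having a common precessor not equal to zero have a largest common precessor. A subset $A\subset\Gamma$ is directed if it is nonempty and any two elements of $A$ have a common $\prec$-lower bound in $A$. For directed sets write $A\prec B$ if for every $b\in B$ there is $a\in A$ with $a\prec b$, and $A\sim B$ if $A\prec B$ and $B\prec A$. $\mathcal{O}(\Gamma)$ is the set of $\sim$-classes $[A]$ of directed sets; with $[A][B]=[AB]$ and $[A]^{-1}=[A^{-1}]$ (elementwise) it is an inverse semigroup whose natural order is $[A]\prec[B]\iff A\prec B$. For $x\in\Gamma$ write $x$ also for $[\{x\}]$. $G_u(\Gamma)$ is the groupoid with underlying set $\mathcal{O}(\Gamma)$, the inversion of $\mathcal{O}(\Gamma)$, and product $XY$ defined iff $X^{-1}X=YY^{-1}$. For $x\in\Gamma$, $U_x=\{X\in G_u(\Gamma):X\prec x\}$; for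 $x_1,\ldots,x_n\prec x$ ($n\ge0$), $U_{x;x_1,\ldots,x_n}=U_x\cap U_{x_1}^c\cap\cdots\cap U_{x_n}^c$. The topology $\mathcal{T}$ on $G_u(\Gamma)$ is the one with basis the sets $U_{x;x_1,\ldots,x_n}$. *)

(* Defs.v *)
From HB Require Import structures.
From mathcomp Require Import all_boot generic_quotient.
From mathcomp Require Import all_classical.
From mathcomp Require Import topology.

Set Implicit Arguments.
Unset Strict Implicit.
Unset Printing Implicit Defensive.

Local Open Scope classical_set_scope.
Local Open Scope quotient_scope.

Local Open Scope group_scope.

(* MathComp's [inv] lives on [baseGroupType], which has a unit; an inverse
   semigroup need not have one, hence a separate inversion [sinv]. *)
HB.mixin Record Semigroup_isInvSemigroup S & Semigroup S := {
  sinv : S -> S;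
  mulgVsg : forall x : S, x * sinv x * x = x;
  mulVsgV : forall x : S, sinv x * x * sinv x = sinv x;
  sinv_uniq : forall x y : S, x * y * x = x -> y * x * y = y -> y = sinv x
}.

#[short(type="invSemigroupType")]
HB.structure Definition InvSemigroup := {S of Semigroup_isInvSemigroup S & Semigroup S}.

Local Notation "x ^-1" := (sinv x) : group_scope.

Reserved Notation "x ≺ y" (at level 70, no associativity).
Definition natle (S : invSemigroupType) (x y : S) : Prop := x * y^-1 = x * x^-1.
Notation "x ≺ y" := (natle x y) : group_scope.

(* At most one such z exists; "c is not 0" is [~ is_zero c], which holds
   for every c when S has no zero. *)
Definition is_zero (S : invSemigroupType) (z : S) : Prop := forall x : S, z ≺ x.

Definition condition_L (S : invSemigroupType) : Prop :=
  forall x y : S,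
    (exists c, [/\ c ≺ x, c ≺ y & ~ is_zero c]) ->
    exists m, [/\ m ≺ x, m ≺ y & forall c, c ≺ x -> c ≺ y -> c ≺ m].

Section InvSemigroupTheory.
Variable S : invSemigroupType.
Implicit Types x y z e f : S.

Definition idem e := e * e = e.

Lemma idemV e : idem e -> e^-1 = e.
Proof. by move=> ee; apply/esym/sinv_uniq; rewrite !ee. Qed.

Lemma sinvK x : x^-1^-1 = x.
Proof. by apply/esym/sinv_uniq; [exact: mulVsgV|exact: mulgVsg]. Qed.

Lemma idemM e f : idem e -> idem f -> idem (e * f).
Proof.
move=> ee ff; set x := (e * f)^-1.
have xE : f * x * e = x.
  apply: sinv_uniq.
  - by rewrite !mulgA -(mulgA e f f) ff -(mulgA (e * f * x) e e) ee
               -[X in _ = X](mulgVsg (e * f)) !mulgA.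
  - rewrite -[RHS](congr1 (fun t => f * t * e) (mulVsgV (e * f))) -/x !mulgA.
    by rewrite -(mulgA (f * x) e e) ee -(mulgA (f * x * e) f f) ff.
have xx : idem x.
  rewrite /idem -{1 2}xE !mulgA.
  have -> : f * x * e * f * x * e = f * (x * (e * f) * x) * e by rewrite !mulgA.
  by rewrite mulVsgV.
by have := idemV xx; rewrite /x sinvK => ->.
Qed.

Lemma idemC e f : idem e -> idem f -> e * f = f * e.
Proof.
move=> ee ff; have := idemM ee ff; have := idemM ff ee => fe ef.
rewrite -[LHS](idemV ef); apply/esym/sinv_uniq.
- rewrite -[RHS]ef !mulgA; congr (_ * _).
  by rewrite -(mulgA e f f) ff -(mulgA (e * f) e e) ee.
- rewrite -[RHS]fe !mulgA; congr (_ * _).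
  by rewrite -(mulgA f e e) ee -(mulgA (f * e) f f) ff.
Qed.

Lemma idemgV x : idem (x * x^-1).
Proof. by rewrite /idem !mulgA mulgVsg. Qed.

Lemma idemVg x : idem (x^-1 * x).
Proof. by rewrite /idem !mulgA mulVsgV. Qed.

Lemma sinvM x y : (x * y)^-1 = y^-1 * x^-1.
Proof.
apply/esym/sinv_uniq.
- have -> : x * y * (y^-1 * x^-1) * (x * y)
           = x * ((y * y^-1) * (x^-1 * x)) * y by rewrite !mulgA.
  by rewrite (idemC (idemgV y) (idemVg x)) !mulgA mulgVsg -!mulgA (mulgA y) mulgVsg.
- have -> : y^-1 * x^-1 * (x * y) * (y^-1 * x^-1)
           = y^-1 * ((x^-1 * x) * (y * y^-1)) * x^-1 by rewrite !mulgA.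
  by rewrite (idemC (idemVg x) (idemgV y)) !mulgA mulVsgV -!mulgA (mulgA (x^-1)) mulVsgV.
Qed.

Lemma idem_conj x e : idem e -> idem (x * e * x^-1).
Proof.
move=> ee; rewrite /idem.
have -> : x * e * x^-1 * (x * e * x^-1) = x * (e * (x^-1 * x) * e) * x^-1
  by rewrite !mulgA.
by rewrite (idemC ee (idemVg x)) -(mulgA (x^-1 * x)) ee !mulgA mulgVsg.
Qed.

Lemma natle_idemr e x : idem e -> x * e ≺ x.
Proof.
by move=> ee; rewrite /natle sinvM (idemV ee) !mulgA -(mulgA x e e) ee.
Qed.

Lemma idemMr e x : idem e -> x * e = (x * e * x^-1) * x.
Proof.
move=> ee.
have -> : x * e * x^-1 * x = x * (e * (x^-1 * x)) by rewrite !mulgA.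
by rewrite (idemC ee (idemVg x)) !mulgA mulgVsg.
Qed.

Lemma idemMl e x : idem e -> e * x = x * (x^-1 * e * x).
Proof.
move=> ee.
have -> : x * (x^-1 * e * x) = (x * x^-1) * e * x by rewrite !mulgA.
by rewrite (idemC (idemgV x) ee) -!mulgA (mulgA x) mulgVsg.
Qed.

Lemma natlePr x y : x ≺ y <-> exists2 e, idem e & x = y * e.
Proof.
split=> [xy|[e ee ->]]; last exact: natle_idemr.
exists (x^-1 * x); first exact: idemVg.
have yx : y * x^-1 = x * x^-1.
  by have := congr1 (@sinv S) xy; rewrite !sinvM !sinvK.
by rewrite mulgA yx mulgVsg.
Qed.

Lemma natlePl x y : x ≺ y <-> exists2 e, idem e & x = e * y.
Proof.
rewrite natlePr; split=> -[e ee ->].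
  by exists (y * e * y^-1); [exact: idem_conj|rewrite -idemMr].
exists (y^-1 * e * y); last by rewrite -idemMl.
by have := idem_conj y^-1 ee; rewrite sinvK.
Qed.

Lemma natle_eql x y : x ≺ y -> x = x * x^-1 * y.
Proof.
move=> /natlePl[e ee ->]; rewrite sinvM (idemV ee).
have -> : e * y * (y^-1 * e) * y = e * ((y * y^-1) * e) * y by rewrite !mulgA.
by rewrite (idemC (idemgV y) ee) !mulgA ee -!mulgA (mulgA y) mulgVsg.
Qed.

Lemma natle_eqr x y : x ≺ y -> x = y * (x^-1 * x).
Proof.
move=> xy.
have yx : y * x^-1 = x * x^-1.
  by have := congr1 (@sinv S) xy; rewrite !sinvM !sinvK.
by rewrite mulgA yx mulgVsg.
Qed.

Lemma natle_refl x : x ≺ x. Proof. by []. Qed.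

Lemma natle_trans y x z : x ≺ y -> y ≺ z -> x ≺ z.
Proof.
move=> /natlePl[e ee ->] /natlePl[f ff ->].
by apply/natlePl; exists (e * f); [exact: idemM|rewrite mulgA].
Qed.

Lemma natleM x y x' y' : x ≺ x' -> y ≺ y' -> x * y ≺ x' * y'.
Proof.
move=> /natlePr[e ee ->] /natlePl[f ff ->].
apply/natlePl; exists (x' * (e * f) * x'^-1).
  by apply: idem_conj; exact: idemM.
rewrite !mulgA; congr (_ * _).
by rewrite -(mulgA x' e f) -idemMr //; exact: idemM.
Qed.

Lemma natleV x y : x ≺ y -> x^-1 ≺ y^-1.
Proof.
move=> /natlePr[e ee ->]; apply/natlePl; exists e => //.
by rewrite sinvM idemV.
Qed.

End InvSemigroupTheory.

Section Directed.
Variable S : invSemigroupType.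

Definition is_directed (A : set S) : Prop :=
  A !=set0 /\
  forall a b, A a -> A b -> exists c, [/\ A c, c ≺ a & c ≺ b].

Record directedSet := DirectedSet {
  dset :> set S;
  dsetP : is_directed dset
}.

HB.instance Definition _ := gen_eqMixin directedSet.
HB.instance Definition _ := gen_choiceMixin directedSet.

Implicit Types A B C : directedSet.

Definition dle A B : Prop := forall b, dset B b -> exists2 a, dset A a & a ≺ b.

Definition dequiv A B : bool := `[< dle A B /\ dle B A >].

Lemma dle_refl A : dle A A.
Proof. by move=> a Aa; exists a. Qed.

Lemma dle_trans B A C : dle A B -> dle B C -> dle A C.
Proof.
move=> AB BC c /BC[b /AB[a Aa ab] bc]; exists a => //.
exact: natle_trans ab bc.
Qed.

Lemma dequivP A B : reflect (dle A B /\ dle B A) (dequiv A B).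
Proof. exact: asboolP. Qed.

Lemma dequiv_refl : reflexive dequiv.
Proof. by move=> A; apply/dequivP; split; exact: dle_refl. Qed.

Lemma dequiv_sym : symmetric dequiv.
Proof. by move=> A B; apply/dequivP/dequivP => -[]. Qed.

Lemma dequiv_trans : transitive dequiv.
Proof.
move=> B A C /dequivP[AB BA] /dequivP[BC CB]; apply/dequivP.
by split; [exact: dle_trans AB BC|exact: dle_trans CB BA].
Qed.

Canonical dequiv_equiv := EquivRel dequiv dequiv_refl dequiv_sym dequiv_trans.

Definition setM (A B : set S) : set S := [set x * y | x in A & y in B].
Definition setV (A : set S) : set S := [set x^-1 | x in A].

Lemma setM_directed A B : is_directed (setM A B).
Proof.
case: A B => [A [[a Aa] dA]] [B [[b Bb] dB]] /=; split.
  by exists (a * b), a => //; exists b.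
move=> _ _ [a1 Aa1 [b1 Bb1 <-]] [a2 Aa2 [b2 Bb2 <-]].
have [a3 [? ? ?]] := dA _ _ Aa1 Aa2; have [b3 [? ? ?]] := dB _ _ Bb1 Bb2.
exists (a3 * b3); split; [|exact: natleM..].
by exists a3 => //; exists b3.
Qed.

Lemma setV_directed A : is_directed (setV A).
Proof.
case: A => [A [[a Aa] dA]] /=; split; first by exists a^-1, a.
move=> _ _ [a1 Aa1 <-] [a2 Aa2 <-].
have [a3 [? ? ?]] := dA _ _ Aa1 Aa2.
by exists a3^-1; split; [exists a3|exact: natleV..].
Qed.

Lemma set1_directed (x : S) : is_directed [set x].
Proof. by split; [exists x|move=> _ _ -> ->; exists x]. Qed.

Definition dmul A B := DirectedSet (setM_directed A B).
Definition dinv A := DirectedSet (setV_directed A).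
Definition dpt x := DirectedSet (set1_directed x).

Lemma dmulP A B a b : dset A a -> dset B b -> dset (dmul A B) (a * b).
Proof. by move=> Aa Bb; exists a => //; exists b. Qed.

Lemma dinvP A a : dset A a -> dset (dinv A) a^-1.
Proof. by exists a. Qed.

Lemma dset_lb A a b : dset A a -> dset A b -> exists c, [/\ dset A c, c ≺ a & c ≺ b].
Proof. exact: (dsetP A).2. Qed.

Lemma dle_mul A B A' B' : dle A A' -> dle B B' -> dle (dmul A B) (dmul A' B').
Proof.
move=> AA BB _ [a' /AA[a Aa aa'] [b' /BB[b Bb bb'] <-]].
by exists (a * b); [exact: dmulP|exact: natleM].
Qed.

Lemma dle_inv A B : dle A B -> dle (dinv A) (dinv B).
Proof.
move=> AB _ [b /AB[a Aa ab] <-].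
by exists a^-1; [exact: dinvP|exact: natleV].
Qed.

Lemma dmulA A B C : dset (dmul A (dmul B C)) = dmul (dmul A B) C.
Proof.
apply/seteqP; split.
- move=> _ [a Aa [_ [b Bb [c Cc <-]] <-]]; rewrite mulgA.
  by do 2 apply: dmulP => //.
- move=> _ [_ [a Aa [b Bb <-]] [c Cc <-]]; rewrite -mulgA.
  by do 2 apply: dmulP => //.
Qed.

Lemma dmulVK A : dequiv (dmul (dmul A (dinv A)) A) A.
Proof.
apply/dequivP; split.
- move=> a Aa; exists (a * a^-1 * a); last by rewrite mulgVsg.
  by do ![apply: dmulP => // | apply: dinvP].
- move=> _ [_ [a Aa [_ [b Ab <-] <-]] [c Ac <-]].
  have [d [Ad da db]] := dset_lb Aa Ab; have [e [Ae ed ec]] := dset_lb Ad Ac.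
  exists e => //; rewrite -[e]mulgVsg.
  apply: natleM ec; apply: natleM; first exact: natle_trans ed da.
  by apply: natleV; exact: natle_trans ed db.
Qed.

Lemma dinvMV A : dequiv (dmul (dmul (dinv A) A) (dinv A)) (dinv A).
Proof.
have := dmulVK (dinv A).
suff -> : dinv (dinv A) = A by [].
case: A => A dA; rewrite /dinv /=.
move: (setV_directed _) => /=.
suff -> : setV (setV A) = A by move=> p; congr DirectedSet; exact: Prop_irrelevance.
apply/seteqP; split=> [_ [_ [a Aa <-] <-]|a Aa]; first by rewrite sinvK.
by exists a^-1; [exists a|rewrite sinvK].
Qed.

Lemma didem A : dequiv (dmul A A) A ->
  forall a, dset A a -> exists2 e, idem e & dset A e /\ e ≺ a.
Proof.
move=> /dequivP[AAA AAA'] a Aa.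
have [_ [a1 A1 [a2 A2 <-]] le] := AAA _ Aa.
have [a12 [A12 le1 le2]] := dset_lb A1 A2.
have [b [Ab lb ba]] := dset_lb A12 Aa.
have [c Ac cbb] := AAA' _ (dmulP Ab Ab).
have [d [Ad dc db]] := dset_lb Ac Ab.
have dbb := natle_trans dc cbb.
exists d; last by split=> //; exact: natle_trans db ba.
have E1 := natle_eql db; have E2 := natle_eql dbb.
have E3 : d * b = d by rewrite {1}E1 -mulgA -E2.
have E5 := natle_eqr db.
by rewrite /idem {2}E5 mulgA E3 mulgA mulgVsg.
Qed.

End Directed.

Section DirectedClasses.
Variable S : invSemigroupType.
Implicit Types A B : directedSet S.

(* O(S). Lemma [natleO_pi] below identifies its natural order with [dle]. *)
Definition OO : Type := {eq_quot (@dequiv S)}.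
HB.instance Definition _ := Choice.on OO.
HB.instance Definition _ := Quotient.on OO.
HB.instance Definition _ := EqQuotient.on OO.
Implicit Types X Y Z : OO.

Lemma OOP A B : \pi_OO A = \pi_OO B <-> dle A B /\ dle B A.
Proof. by split=> [/eqP|] h; [|apply/eqP]; move: h; rewrite eqmodE => /dequivP. Qed.

Definition Omul X Y : OO := \pi_OO (dmul (repr X) (repr Y)).
Definition Oinv X : OO := \pi_OO (dinv (repr X)).

Lemma repr_pi A : dle (repr (\pi_OO A)) A /\ dle A (repr (\pi_OO A)).
Proof. by apply/OOP; rewrite reprK. Qed.

Lemma Omul_pi A B : Omul (\pi_OO A) (\pi_OO B) = \pi_OO (dmul A B).
Proof.
have [? ?] := repr_pi A; have [? ?] := repr_pi B.
by apply/OOP; split; exact: dle_mul.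
Qed.

Lemma Oinv_pi A : Oinv (\pi_OO A) = \pi_OO (dinv A).
Proof. by have [? ?] := repr_pi A; apply/OOP; split; exact: dle_inv. Qed.

Lemma OO_ind (P : OO -> Prop) : (forall A, P (\pi_OO A)) -> forall X, P X.
Proof. by move=> h X; rewrite -[X]reprK. Qed.

Lemma OmulA : associative Omul.
Proof.
elim/OO_ind=> A; elim/OO_ind=> B; elim/OO_ind=> C.
rewrite !Omul_pi; apply/OOP; split=> x.
  by rewrite -dmulA; exists x.
by rewrite dmulA; exists x.
Qed.

HB.instance Definition _ := isSemigroup.Build OO OmulA.

Lemma mulO_pi A B : \pi_OO A * \pi_OO B = \pi_OO (dmul A B).
Proof. exact: Omul_pi. Qed.

Lemma OmulVK X : X * Oinv X * X = X.
Proof.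
elim/OO_ind: X => A.
by rewrite Oinv_pi !mulO_pi; apply/OOP/dequivP; exact: dmulVK.
Qed.

Lemma OinvMV X : Oinv X * X * Oinv X = Oinv X.
Proof.
elim/OO_ind: X => A.
by rewrite Oinv_pi !mulO_pi; apply/OOP/dequivP; exact: dinvMV.
Qed.

Lemma Oidem_lb A : \pi_OO A * \pi_OO A = \pi_OO A ->
  forall a, dset A a -> exists2 e, idem e & dset A e /\ e ≺ a.
Proof. by rewrite mulO_pi => /OOP /dequivP; exact: didem. Qed.

Lemma OidemC X Y : X * X = X -> Y * Y = Y -> X * Y = Y * X.
Proof.
elim/OO_ind: X => A; elim/OO_ind: Y => B /Oidem_lb hA /Oidem_lb hB.
rewrite !mulO_pi; apply/OOP; split.
- move=> _ [b /hB[f ff [Bf fb]] [a /hA[e ee [Ae ea]] <-]].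
  by exists (e * f); [exact: dmulP|rewrite (idemC ee ff); exact: natleM].
- move=> _ [a /hA[e ee [Ae ea]] [b /hB[f ff [Bf fb]] <-]].
  by exists (f * e); [exact: dmulP|rewrite (idemC ff ee); exact: natleM].
Qed.

Lemma Oinv_uniq X Y : X * Y * X = X -> Y * X * Y = Y -> Y = Oinv X.
Proof.
move=> h1 h2; set Z := Oinv X; have h3 := OmulVK X; have h4 := OinvMV X.
rewrite -/Z in h3 h4.
have XY : (X * Y) * (X * Y) = X * Y by rewrite mulgA h1.
have YX : (Y * X) * (Y * X) = Y * X by rewrite mulgA h2.
have XZ : (X * Z) * (X * Z) = X * Z by rewrite mulgA h3.
have ZX : (Z * X) * (Z * X) = Z * X by rewrite mulgA h4.
have -> : Y = Y * X * Z.
  rewrite -{1}h2 -{1}h3.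
  have -> : Y * (X * Z * X) * Y = Y * ((X * Z) * (X * Y)) by rewrite !mulgA.
  by rewrite (OidemC XZ XY) !mulgA h2.
rewrite -[RHS]h4 -{2}h1.
have -> : Z * (X * Y * X) * Z = (Z * X) * (Y * X) * Z by rewrite !mulgA.
by rewrite (OidemC ZX YX) -!mulgA (mulgA Z) h4.
Qed.

HB.instance Definition _ :=
  Semigroup_isInvSemigroup.Build OO OmulVK OinvMV Oinv_uniq.

Lemma invO_pi A : (\pi_OO A)^-1 = \pi_OO (dinv A).
Proof. exact: Oinv_pi. Qed.

Lemma natleO_pi A B : \pi_OO A ≺ \pi_OO B <-> dle A B.
Proof.
split=> [/natlePl[E]|AB].
  elim/OO_ind: E => E Eid; rewrite mulO_pi => /OOP[AEB _] b Bb.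
  have [e0 Ee0] := (dsetP E).1.
  have [e ee [Ee _]] := Oidem_lb Eid Ee0.
  have [a Aa aeb] := AEB _ (dmulP Ee Bb).
  by exists a => //; apply: natle_trans aeb _; apply/natlePl; exists e.
rewrite /natle !invO_pi !mulO_pi; apply/OOP; split.
- move=> _ [a1 A1 [_ [a2 A2 <-] <-]].
  have [a [Aa l1 l2]] := dset_lb A1 A2.
  have [b Bb] := (dsetP B).1; have [a' A' a'b] := AB b Bb.
  have [c [Ac ca ca']] := dset_lb Aa A'.
  exists (c * b^-1); first by apply: dmulP => //; exact: dinvP.
  rewrite (natle_trans ca' a'b).
  by apply: natleM; [|apply: natleV]; exact: natle_trans ca _.
- move=> _ [a Aa [_ [b Bb <-] <-]].
  have [a' A' a'b] := AB b Bb; have [c [Ac ca ca']] := dset_lb Aa A'.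
  exists (c * c^-1); first by apply: dmulP => //; exact: dinvP.
  by apply: natleM => //; apply: natleV; exact: natle_trans ca' a'b.
Qed.

(* The class of {x}, i.e. x viewed in O(S). *)
Definition Opt (x : S) : OO := \pi_OO (dpt x).

End DirectedClasses.

Definition Gu (S : invSemigroupType) : Type := OO S.
HB.instance Definition _ (S : invSemigroupType) := InvSemigroup.on (Gu S).

(* The groupoid product: the inverse semigroup product, restricted. *)
Definition Gu_mul (S : invSemigroupType) (X Y : Gu S) : option (Gu S) :=
  if X^-1 * X == Y * Y^-1 then Some (X * Y) else None.

Section Topology.
Variable S : invSemigroupType.
Implicit Types (x y z : S) (s : seq S) (X Y : Gu S).

Definition Uset x : set (Gu S) := [set X | X ≺ Opt x].

Definition Ubase x s : set (Gu S) :=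
  Uset x `&` \bigcap_(y in [set` s]) ~` Uset y.

Definition basisT : set (set (Gu S)) :=
  [set B | exists x s, (forall y, y \in s -> y ≺ x) /\ B = Ubase x s].

Lemma Uset_pi (A : directedSet S) x :
  Uset x (\pi_(OO S) A) <-> exists2 a, dset A a & a ≺ x.
Proof.
rewrite /Uset /= /Opt; split=> [/natleO_pi /(_ x erefl)//|ax].
by apply/natleO_pi => _ ->.
Qed.

Lemma Uset_le x y : x ≺ y -> Uset x `<=` Uset y.
Proof.
move=> xy; elim/OO_ind=> A /Uset_pi[a Aa ax]; apply/Uset_pi; exists a => //.
exact: natle_trans ax xy.
Qed.

Lemma UsetI (b y x : S) : b ≺ x -> y ≺ x ->
  b * b^-1 * y ≺ b /\ Uset b `&` Uset y = Uset (b * b^-1 * y).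
Proof.
move=> bx yx.
have le1 : b * b^-1 * y ≺ b.
  move/natlePr: yx => [g gg ->]; rewrite mulgA -natle_eql//.
  exact: natle_idemr.
have le2 : b * b^-1 * y ≺ y.
  by apply/natlePl; exists (b * b^-1) => //; exact: idemgV.
split=> //; apply/seteqP; split; last first.
  by move=> X UX; split; [exact: Uset_le le1 _ UX|exact: Uset_le le2 _ UX].
elim/OO_ind=> A [/Uset_pi[a1 A1 l1] /Uset_pi[a2 A2 l2]].
have [c [Ac c1 c2]] := dset_lb A1 A2.
apply/Uset_pi; exists c => //.
have cb := natle_trans c1 l1; have cy := natle_trans c2 l2.
rewrite (natle_eql cy); apply: natleM => //; apply: natleM => //.
exact: natleV.
Qed.

Lemma basisT_cover : \bigcup_(B in basisT) B = setT.
Proof.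
apply/seteqP; split=> // X _.
elim/OO_ind: X => A; have [a Aa] := (dsetP A).1.
exists (Ubase a [::]); first by exists a, [::].
by split=> //; apply/Uset_pi; exists a.
Qed.

Lemma basisT_join (B C : set (Gu S)) X : basisT B -> basisT C -> B X -> C X ->
  exists D, [/\ basisT D, D X & D `<=` B `&` C].
Proof.
move=> [x [s [sx ->]]] [y [t [ty ->]]] [Ux Us] [Uy Ut].
have [c [Uc cx cy]] : exists c, [/\ Uset c X, c ≺ x & c ≺ y].
  move: Ux Uy {Us Ut}; elim/OO_ind: X => A /Uset_pi[a Aa ax] /Uset_pi[b Ab by_].
  have [c [Ac ca cb]] := dset_lb Aa Ab; exists c; split.
  - by apply/Uset_pi; exists c.
  - exact: natle_trans ca ax.
  - exact: natle_trans cb by_.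
pose m z := c * c^-1 * z.
have mP z : z \in s ++ t -> m z ≺ c /\ Uset c `&` Uset z = Uset (m z).
  by rewrite mem_cat => /orP[/sx|/ty]; [exact: UsetI cx|exact: UsetI cy].
exists (Ubase c (map m (s ++ t))); split.
- exists c, (map m (s ++ t)); split=> // _ /mapP[z zst ->].
  by have [] := mP z zst.
- split=> // _ /mapP[z zst ->]; have [_ <-] := mP z zst.
  move=> [_ Uz]; move: zst; rewrite mem_cat => /orP[zs|zt].
    exact: Us Uz.
  exact: Ut Uz.
- move=> Y [UcY nY].
  have nz z : z \in s ++ t -> ~ Uset z Y.
    move=> zst Uz; have [_ mE] := mP z zst.
    by apply: (nY (m z)); [exact: map_f|rewrite -mE].
  split; (split; first by [exact: Uset_le cx _ UcY|exact: Uset_le cy _ UcY]);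
    by move=> z /= zs; apply: nz; rewrite mem_cat zs ?orbT.
Qed.

HB.instance Definition _ := isBaseTopological.Build (Gu S) basisT_cover basisT_join.

Lemma openT_basis (V : set (Gu S)) :
  open V <-> exists2 F, F `<=` basisT & V = \bigcup_(B in F) B.
Proof. by split=> [[F FT <-]|[F FT ->]]; exists F. Qed.

Definition jmap X : prod_topology (fun _ : S => bool) :=
  fun x => `[< X ≺ Opt x >].

Definition Gu_open (V : set (Gu S)) : Prop := @open (Gu S) V.

Definition induced_open (V : set (Gu S)) : Prop :=
  @open (initial_topology jmap) V.

End Topology.

(* Main.v *)
Require Import Defs.
From mathcomp Require Import all_boot all_classical.
From mathcomp Require Import topology.

Local Open Scope classical_set_scope.
Local Open Scope group_scope.

(** For directed sets [A], [B], the relation [A ≺ B] only tests [A ≺ b] for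
    [b ∈ B], so a class is determined by its image under [j]. The sets [U_x] and
    their complements form a subbasis of the induced topology, so the point is
    that every complement of [U_x] is open for [T]. Any [X] lies in some [U_a]; if
    [U_a] meets [U_x] then [a] and [x] have a common precessor, (L) gives a largest
    one [m], and [U_a ∩ U_x = U_m]; hence [U_{a;m}] is a neighbourhood of [X]
    avoiding [U_x]. *)

Section GroupoidTopology.
Variable S : invSemigroupType.
Implicit Types (x y : S) (X Y : Gu S) (V : set (Gu S)).

Lemma Uset_cover X : exists x, Uset x X.
Proof.
elim/OO_ind: X => A; have [a Aa] := (dsetP A).1.
by exists a; apply/Uset_pi; exists a.
Qed.

(** A lower bound taken inside a directed representative of [X] still lies above [X]. *)
Lemma UsetI_lb x y X : Uset x X -> Uset y X ->
  exists c, [/\ Uset c X, c ≺ x & c ≺ y].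
Proof.
elim/OO_ind: X => A /Uset_pi[a Aa ax] /Uset_pi[b Ab yb].
have [c [Ac ca cb]] := dset_lb Aa Ab.
exists c; split; first by apply/Uset_pi; exists c.
- exact: natle_trans ca ax.
- exact: natle_trans cb yb.
Qed.

(** It suffices to test the members of a directed representative of [Y], all of which lie above
    [Y]. *)
Lemma natleO_Uset X Y : (forall x, Uset x Y -> Uset x X) -> X ≺ Y.
Proof.
elim/OO_ind: X => A; elim/OO_ind: Y => B BA; apply/natleO_pi => b Bb.
by apply/Uset_pi/BA/Uset_pi; exists b.
Qed.

Lemma natleO_anti X Y : X ≺ Y -> Y ≺ X -> X = Y.
Proof.
elim/OO_ind: X => A; elim/OO_ind: Y => B /natleO_pi AB /natleO_pi BA.
exact/OOP.
Qed.

Lemma jmapE x X : jmap X x = `[< Uset x X >]. Proof. by []. Qed.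

Lemma jmap_inj : injective (@jmap S).
Proof.
move=> X Y jXY.
have UE x : Uset x X <-> Uset x Y.
  by apply: asbool_eq_equiv; rewrite -!jmapE jXY.
by apply: natleO_anti; apply: natleO_Uset => x /UE.
Qed.

Lemma Gu_open_Ubase x (s : seq S) : (forall y, y \in s -> y ≺ x) ->
  Gu_open (Ubase x s).
Proof.
move=> sx; apply/openT_basis; exists [set Ubase x s]; last by rewrite bigcup_set1.
by move=> _ ->; exists x, s.
Qed.

Lemma Gu_open_Uset x : Gu_open (Uset x).
Proof.
suff <- : Ubase x [::] = Uset x by exact: Gu_open_Ubase.
by apply/seteqP; split=> [X []|X UX].
Qed.

(* When all common precessors of [x] and [y] are zero, a zero one is itself
   the largest, so (L) applies without the nonvanishing condition. *)
Lemma condition_L_meet x y : condition_L S ->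
  (exists c, c ≺ x /\ c ≺ y) ->
  exists m, [/\ m ≺ x, m ≺ y & forall c, c ≺ x -> c ≺ y -> c ≺ m].
Proof.
move=> hL [c [cx cy]].
have [nz|/forallNP allz] := pselect (exists d, [/\ d ≺ x, d ≺ y & ~ is_zero d]).
  exact: hL.
exists c; split=> // d dx dy.
by have /contrapT z : ~ ~ is_zero d by [move=> nz; apply: (allz d)]; exact: z.
Qed.

Lemma Gu_open_UsetC x : condition_L S -> Gu_open (~` Uset x).
Proof.
move=> hL; rewrite /Gu_open openE => X /= nxX; rewrite /interior nbhsE.
have [a aX] := Uset_cover X.
have [[Y [aY xY]]|disj] := pselect (Uset a `&` Uset x !=set0); last first.
  exists (Uset a); first by split=> //; exact: Gu_open_Uset.
  by move=> Y aY xY; apply: disj; exists Y.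
have [c [_ ca cx]] := UsetI_lb _ _ _ aY xY.
have [m [ma mx mP]] : exists m,
    [/\ m ≺ a, m ≺ x & forall c, c ≺ a -> c ≺ x -> c ≺ m].
  by apply: condition_L_meet => //; exists c.
exists (Ubase a [:: m]).
  split; first by apply: Gu_open_Ubase => y; rewrite inE => /eqP ->.
  split=> // y /=; rewrite inE => /eqP -> mX; apply: nxX.
  exact: Uset_le mx _ mX.
(* A point [Z] of [Uset x] in this neighbourhood would lie below some [d ≺ m], hence in the excluded
   [Uset m]. *)
move=> Z [aZ nmZ] xZ; have [d [dZ da dx]] := UsetI_lb _ _ _ aZ xZ.
apply: (nmZ m); first by rewrite /= inE.
exact: Uset_le (mP _ da dx) _ dZ.
Qed.

(** The product topology is the supremum of those pulled back along the coordinates, so one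
    coordinate at a time suffices. *)
Lemma jmap_continuous : condition_L S -> continuous (@jmap S).
Proof.
move=> hL X; apply/cvg_sup; first exact/fmap_filter/nbhs_filter.
move=> x; move: X.
apply/(@continuousP _ (initial_topology (@^~ x))) => _ [A _ <-].
(* Split by the value at [x]: whether [A] contains that value is then a constant condition, keeping
   all or nothing of each piece. *)
have -> : @jmap S @^-1` (@^~ x @^-1` A) =
    (Uset x `&` [set _ | A true]) `|` (~` Uset x `&` [set _ | A false]).
  apply/seteqP; split=> X /=; rewrite ?jmapE; case: asboolP => xX; tauto.
have openP (P : Prop) V : Gu_open V -> Gu_open (V `&` [set _ | P]).
  have [p|np] := pselect P => oV.
    by rewrite (_ : [set _ | P] = setT) ?setIT//; apply/seteqP; split.
  by rewrite (_ : [set _ | P] = set0) ?setI0; [exact: open0|apply/seteqP; split].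
by apply: openU; apply: openP; [exact: Gu_open_Uset|exact: Gu_open_UsetC].
Qed.

Lemma induced_open_jmap_eq x (b : bool) : induced_open [set X | jmap X x = b].
Proof.
have oJ := @initial_continuous (Gu S) _ (@jmap S).
have opx : continuous (fun f : prod_topology (fun _ : S => bool) => f x).
  exact: (@proj_continuous S (fun _ => bool) x).
(* The ascription selects the induced topology on the source; [Gu S] itself carries the basis
   topology. *)
apply: (open_comp (f := @jmap S : initial_topology (@jmap S) -> _)
  (D := [set f | f x = b])) => [X _|]; first exact: oJ.
apply: (open_comp (D := [set b])) => [f _|]; first exact: opx.
exact: discrete_open.
Qed.

Lemma induced_open_Uset x : induced_open (Uset x).
Proof.
rewrite (_ : Uset x = [set X | jmap X x = true]); first exact: induced_open_jmap_eq.
by apply/seteqP; split=> X; rewrite /= jmapE => /asboolP.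
Qed.

Lemma induced_open_UsetC x : induced_open (~` Uset x).
Proof.
rewrite (_ : ~` _ = [set X | jmap X x = false]); first exact: induced_open_jmap_eq.
by apply/seteqP; split=> X /=; rewrite jmapE; case: asboolP.
Qed.

(** Only finitely many complements are intersected, by induction along [s]. *)
Lemma induced_open_Ubase x (s : seq S) : induced_open (Ubase x s).
Proof.
apply: openI; first exact: induced_open_Uset.
rewrite bigcap_seq; elim/big_ind: _ => [|A B|y _]; [exact: openT|exact: openI|].
exact: induced_open_UsetC.
Qed.

End GroupoidTopology.

Theorem lemma4p9 (S : invSemigroupType) :
  injective (@jmap S) /\
  (condition_L S -> forall V : set (Gu S), induced_open V <-> Gu_open V).
Proof.
split=> [|hL V]; first exact: jmap_inj.
split=> [[W oW <-]|/openT_basis[F FT ->]].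
  by move/continuousP: (jmap_continuous S hL); exact.
by apply: bigcup_open => _ /FT[x [s [_ ->]]]; exact: induced_open_Ubase.
Qed.
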